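(* (1) If $\eta:F^\times\to\overline{\mathbb{F}}_p^\times$ is a smooth character defining a principal series representation of $G=GL_2(F)$ (i.e. such that $Ind_B^G(\eta\otimes\mathbf 1)$ is irreducible), then there is a natural isomorphism of $G_S$-representations $$Ind_B^G(\eta\otimes\mathbf 1)\simeq Ind_{B_S}^{G_S}(\eta).$$ (2) There is a natural isomorphism of $G_S$-representations $Sp\simeq Sp_S$. (3) The restriction to $G_S$ of the representation $Ind_B^G(\mathbf 1)$ is naturally isomorphic to $Ind_{B_S}^{G_S}(\mathbf 1)$.
   Context: $p$ is a prime, $F$ is a complete non-archimedean local field (of any characteristic) with residue characteristic $p$ and finite residue field; all representations are over $\overline{\mathbb{F}}_p$. $G=GL_2(F)$, $G_S=SL_2(F)$, $B$ (resp. $B_S$) is the subgroup of upper triangular matrices of $G$ (resp. $G_S$). For smooth characters $\eta_1,\eta_2:F^\times\to\overline{\mathbb{F}}_p^\times$, $\eta_1\otimes\eta_2$ is the character $\begin{pmatrix}a&b\\0&d\end{pmatrix}\mapsto\eta_1(a)\eta_2(d)$ of $B$; a smooth character $\eta$ of $F^\times$ is viewed as the character $\begin{pmatrix}a&b\\0&a^{-1}\end{pmatrix}\mapsto\eta(a)$ of $B_S$. For a smooth character $\chi$ of $B$, $Ind_B^G(\chi)$ is the space of locally constant $f:G\to\overline{\mathbb{F}}_p$ with $f(bg)=\chi(b)f(g)$ for all $b\in B$, $g\in G$, with $G$ acting by right translations; $Ind_{B_S}^{G_S}$ is defined in the same way. Such an induced representation is called a principal series representation when it is irreducible. $\mathbf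 1$ denotes a trivial character, as well as the subrepresentation of constant functions. $Sp:=Ind_B^G(\mathbf 1)/\mathbf 1$ and $Sp_S:=Ind_{B_S}^{G_S}(\mathbf 1)/\mathbf 1$ are the quotients by the constant functions. Representations of $G$ are regarded as $G_S$-representations by restriction. *)

(* Defs.v *)
From HB Require Import structures.
From mathcomp Require Import all_boot all_order all_algebra.
From mathcomp Require Import boolp classical_sets functions cardinality.
From mathcomp Require Import topology ring perm.

Set Implicit Arguments.
Unset Strict Implicit.
Unset Printing Implicit Defensive.
Import Order.TTheory GRing.Theory Num.Theory.
Local Open Scope classical_set_scope.
Local Open Scope ring_scope.

(* The valuation is normalised. Its value at 0 is junk: everywhere below, 0   *)
(* is treated as having valuation +oo.                                        *)
HB.mixin Record isDiscretelyValued F of GRing.Field F & Uniform F := {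
  valuation : F -> int;
  valuationM : forall x y : F, x != 0 -> y != 0 ->
    valuation (x * y) = valuation x + valuation y;
  valuationD : forall x y : F, x != 0 -> y != 0 -> x + y != 0 ->
    Num.min (valuation x) (valuation y) <= valuation (x + y);
  valuation_normalized : exists2 x : F, x != 0 & valuation x = 1;
  entourage_valuation : @entourage F = filter_from setT
    (fun n : int => [set xy | (xy.1 == xy.2) || (n <= valuation (xy.1 - xy.2))])
}.

#[short(type="completeDVFieldType")]
HB.structure Definition CompleteDVField :=
  {F of GRing.Field F & Complete F & isDiscretelyValued F}.

Section Valuation.
Variable F : completeDVFieldType.

Definition val_ge (n : int) : {pred F} :=
  fun x : F => (x == 0) || (n <= valuation x).

Lemma valuation1 : valuation (1 : F) = 0.
Proof.
have := @valuationM F 1 1 (oner_neq0 _) (oner_neq0 _).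
by rewrite mulr1 => /eqP; rewrite -subr_eq0 opprD addNKr oppr_eq0 => /eqP.
Qed.

Lemma valuationN1 : valuation (-1 : F) = 0.
Proof.
have n0 : (-1 : F) != 0 by rewrite oppr_eq0 oner_eq0.
have := @valuationM F (-1) (-1) n0 n0.
rewrite mulrNN mulr1 valuation1 -mulr2n => /esym/eqP.
by rewrite mulrn_eq0 => /eqP.
Qed.

Lemma val_geM m n (x y : F) : x \in val_ge m -> y \in val_ge n ->
  x * y \in val_ge (m + n).
Proof.
rewrite /val_ge !unfold_in; have [->|x0] := eqVneq x 0; first by rewrite mul0r eqxx.
have [->|y0] := eqVneq y 0; first by rewrite mulr0 eqxx.
by move=> /= hx hy; rewrite valuationM// lerD// orbT.
Qed.

Lemma val_geD n (x y : F) : x \in val_ge n -> y \in val_ge n -> x + y \in val_ge n.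
Proof.
rewrite /val_ge !unfold_in; have [->|x0] := eqVneq x 0.
  by rewrite add0r.
have [->|y0] := eqVneq y 0; first by rewrite addr0 (negPf x0).
have [->//|xy0] := eqVneq (x + y) 0 => /= hx hy.
by apply: (le_trans _ (valuationD x y x0 y0 xy0)); rewrite le_min hx hy.
Qed.

Lemma val_geN n (x : F) : (- x \in val_ge n) = (x \in val_ge n).
Proof.
have h z : z \in val_ge n -> - z \in val_ge n.
  move=> hz; rewrite -mulN1r -[n]add0r; apply: val_geM => //.
  by rewrite /val_ge unfold_in valuationN1 lexx orbT.
by apply/idP/idP => /h //; rewrite opprK.
Qed.

Lemma val_geW m n (x : F) : m <= n -> x \in val_ge n -> x \in val_ge m.
Proof.
by move=> mn; rewrite /val_ge !unfold_in => /orP[->//|/(le_trans mn) ->]; rewrite orbT.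
Qed.

Definition integers : {pred F} := val_ge 0.

Lemma integers_subring : subring_closed integers.
Proof.
split=> [|x y hx hy|x y hx hy].
- by rewrite /integers /val_ge unfold_in valuation1 lexx orbT.
- by apply: val_geD => //; rewrite val_geN.
- by rewrite /integers -[0]addr0; apply: val_geM.
Qed.
HB.instance Definition _ := GRing.isSubringClosed.Build F integers integers_subring.

Definition integer_ring := {x : F | x \in integers}.
HB.instance Definition _ := [isSub of integer_ring for @sval F _].
HB.instance Definition _ := [Choice of integer_ring by <:].
HB.instance Definition _ := [SubChoice_isSubComNzRing of integer_ring by <:].

Definition maximal_ideal : {pred integer_ring} :=
  fun x : integer_ring => val x \in val_ge 1.

Lemma maximal_ideal_closed : idealr_closed maximal_ideal.
Proof.
have E (x : integer_ring) : (x \in maximal_ideal) = (val x \in val_ge 1) by [].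
split; rewrite ?E.
- by rewrite rmorph0 /val_ge unfold_in eqxx.
- by rewrite rmorph1 /val_ge unfold_in valuation1 oner_eq0.
- move=> a x y; rewrite !E rmorphD rmorphM => hx hy.
  by apply: val_geD => //; rewrite -[1]add0r; apply: val_geM => //; exact: valP.
Qed.
HB.instance Definition _ := isIdealr.Build integer_ring maximal_ideal maximal_ideal_closed.

(* The library ring structure suffices for cardinality and characteristic. *)
Definition residue_field : comNzRingType := {ideal_quot maximal_ideal}.

End Valuation.

Section ValuationTopology.
Variable F : completeDVFieldType.

Lemma nbhs_valP (x : F) (A : set F) :
  nbhs x A <-> exists n : int, forall y, y - x \in val_ge n -> A y.
Proof.
rewrite nbhsP entourage_valuation; split.
  case=> E [n _ sE] sA; exists n => y hy; apply: sA; apply/xsectionP/sE => /=.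
  by move: hy; rewrite -val_geN opprB /val_ge unfold_in subr_eq0.
case=> n sA; exists [set xy | (xy.1 == xy.2) || (n <= valuation (xy.1 - xy.2))].
  by exists n.
move=> y /xsectionP /= hy; apply: sA.
by rewrite -val_geN opprB /val_ge unfold_in subr_eq0.
Qed.

Lemma val_ge_ex (x : F) : exists n : int, x \in val_ge n.
Proof. by exists (valuation x); rewrite /val_ge unfold_in lexx orbT. Qed.

Variable T : topologicalType.
Implicit Types f g : T -> F.

Lemma continuous_valP f : continuous f <->
  forall t n, \forall s \near t, f s - f t \in val_ge n.
Proof.
split=> [cf t n|hf t A /nbhs_valP[n sA]].
  apply: (cf t [set y | y - f t \in val_ge n]).
  by apply/nbhs_valP; exists n.
by near=> s; apply: sA; near: s; exact: hf.
Unshelve. all: by end_near. Qed.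

Lemma continuousD_val f g : continuous f -> continuous g ->
  continuous (fun t => f t + g t).
Proof.
move=> /continuous_valP cf /continuous_valP cg; apply/continuous_valP => t n.
near=> s; rewrite opprD addrACA; apply: val_geD; near: s; [exact: cf|exact: cg].
Unshelve. all: by end_near. Qed.

Lemma continuousM_val f g : continuous f -> continuous g ->
  continuous (fun t => f t * g t).
Proof.
move=> /continuous_valP cf /continuous_valP cg; apply/continuous_valP => t n.
have [a fa] := val_ge_ex (f t); have [b gb] := val_ge_ex (g t).
near=> s.
have f1 : f s - f t \in val_ge n by near: s; exact: cf.
have g1 : g s - g t \in val_ge 0 by near: s; exact: cg.
have f2 : f s - f t \in val_ge (n - b) by near: s; exact: cf.
have g2 : g s - g t \in val_ge (n - a) by near: s; exact: cg.
have -> : f s * g s - f t * g t =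
    (f s - f t) * (g s - g t) + (f s - f t) * g t + f t * (g s - g t).
  by ring.
apply: val_geD; first apply: val_geD.
- by rewrite -[n]addr0; apply: val_geM.
- by rewrite -[n](subrK b); apply: val_geM.
- by rewrite -[n](subrK a) [n - a + a]addrC; apply: val_geM.
Unshelve. all: by end_near. Qed.

Lemma continuousV_val f : (forall t, f t != 0) -> continuous f ->
  continuous (fun t => (f t)^-1).
Proof.
move=> f0 /continuous_valP cf; apply/continuous_valP => t n.
set v := valuation (f t).
have vV (x : F) : x != 0 -> valuation x^-1 = - valuation x.
  move=> x0; have := valuationM x x^-1 x0 (invr_neq0 x0).
  by rewrite divff// valuation1 => /eqP; rewrite eq_sym addrC addr_eq0 => /eqP.
near=> s.
have h1 : f s - f t \in val_ge (v + 1) by near: s; exact: cf.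
have h2 : f s - f t \in val_ge (n + v + v) by near: s; exact: cf.
have vs : valuation (f s) <= v.
  rewrite leNgt; apply/negP => lt.
  have hs : f s \in val_ge (v + 1) by rewrite /val_ge unfold_in lezD1 lt orbT.
  have : f t \in val_ge (v + 1).
    by rewrite -val_geN -[- f t](addKr (f s)); apply: val_geD; rewrite ?val_geN// .
  by rewrite /val_ge unfold_in (negPf (f0 t)) /= lezD1 ltxx.
have -> : (f s)^-1 - (f t)^-1 = (f t - f s) * (f s)^-1 * (f t)^-1.
  by field; rewrite !f0.
have hsV : (f s)^-1 \in val_ge (- v).
  by rewrite /val_ge unfold_in vV// lerN2 vs orbT.
have htV : (f t)^-1 \in val_ge (- v).
  by rewrite /val_ge unfold_in vV// lexx orbT.
rewrite (_ : n = n + v + v - v - v); last by rewrite !addrK.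
apply: val_geM => //; apply: val_geM => //; by rewrite -val_geN opprB.
Unshelve. all: by end_near. Qed.

Lemma continuous_det n (A : T -> 'M[F]_n) :
  (forall i j, continuous (fun t => A t i j)) -> continuous (fun t => \det (A t)).
Proof.
move=> cA; rewrite /determinant.
have cprod (s : 'S_n) : continuous (fun t => \prod_i A t i (s i)).
  elim: (index_enum _) => [|i r IH].
    by under eq_fun do rewrite big_nil; exact: cst_continuous.
  by under eq_fun do rewrite big_cons; exact: continuousM_val.
elim: (index_enum _) => [|s r IH].
  by under eq_fun do rewrite big_nil; exact: cst_continuous.
under eq_fun do rewrite big_cons; apply: continuousD_val => //.
apply: continuousM_val => //; exact: cst_continuous.
Qed.

Lemma continuous_mx m n (A : T -> 'M[F]_(m, n)) :
  continuous A <-> forall i j, continuous (fun t => A t i j).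
Proof.
split=> [cA i j t U nU|cA t U [P nP sP]].
  apply: (cA t [set M : 'M[F]_(m, n) | U (M i j)]).
  exists (fun i' j' => if (i' == i) && (j' == j) then U else setT).
    move=> i' j'; case: ifP => [/andP[/eqP-> /eqP->]//|_]; exact: filterT.
  by move=> M /(_ i j); rewrite !eqxx.
have : \forall s \near t, forall i j, P i j (A s i j).
  apply: filter_forall => i; apply: filter_forall => j; exact: cA.
by apply: filterS => s; exact: sP.
Qed.

End ValuationTopology.

HB.mixin Record isTopologicalGroup G of Group G & Topological G := {
  mulg_continuous : continuous (fun x : G * G => (x.1 * x.2)%g);
  invg_continuous : continuous (fun x : G => (x^-1)%g)
}.

#[short(type="topologicalGroupType")]
HB.structure Definition TopologicalGroup :=
  {G of Group G & Topological G & isTopologicalGroup G}.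

Section UnitGroup.
Variable R : unitRingType.

Record unit_group := UnitGroup {
  unit_group_val : R;
  unit_groupP : unit_group_val \is a GRing.unit
}.

HB.instance Definition _ := [isSub for unit_group_val].
HB.instance Definition _ := [Choice of unit_group by <:].

Lemma unit_group_mul_subproof (x y : unit_group) :
  unit_group_val x * unit_group_val y \is a GRing.unit.
Proof. by rewrite unitrMl ?unit_groupP. Qed.

Lemma unit_group_inv_subproof (x : unit_group) : (unit_group_val x)^-1 \is a GRing.unit.
Proof. by rewrite unitrV unit_groupP. Qed.

Let one := UnitGroup (unitr1 R).
Let mul (x y : unit_group) := UnitGroup (unit_group_mul_subproof x y).
Let inv (x : unit_group) := UnitGroup (unit_group_inv_subproof x).

Let mulA : associative mul.
Proof. by move=> x y z; apply: val_inj; rewrite /= mulrA. Qed.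
Let mul1x : left_id one mul.
Proof. by move=> x; apply: val_inj; rewrite /= mul1r. Qed.
Let mulx1 : right_id one mul.
Proof. by move=> x; apply: val_inj; rewrite /= mulr1. Qed.
Let mulVx : left_inverse one inv mul.
Proof. by move=> x; apply: val_inj; rewrite /= mulVr ?unit_groupP. Qed.
Let mulxV : right_inverse one inv mul.
Proof. by move=> x; apply: val_inj; rewrite /= mulrV ?unit_groupP. Qed.

HB.instance Definition _ :=
  isGroup.Build unit_group mulA mul1x mulx1 mulVx mulxV.
End UnitGroup.

Section Groups.
Variable F : completeDVFieldType.

(* Since inversion is continuous on F^* and on GL_2(F) for the topology       *)
(* induced from F, resp. M_2(F), that topology is the usual one.              *)
Definition Fx : Type := unit_group F.
HB.instance Definition _ := Group.on Fx.
HB.instance Definition _ :=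
  Topological.copy Fx (initial_topology (@unit_group_val F)).

Definition GL2 : Type := unit_group 'M[F]_2.
HB.instance Definition _ := Group.on GL2.
Definition GL2_mx (g : GL2) : 'M[F]_2 := unit_group_val g.
HB.instance Definition _ := Topological.copy GL2 (initial_topology GL2_mx).

Lemma continuous_initial (T : topologicalType) (S : choiceType)
    (X : topologicalType) (h : S -> X) (f : T -> initial_topology h) :
  continuous (fun t => h (f t)) -> continuous f.
Proof.
move=> cf; apply/continuousP => _ [A oA <-].
by move/continuousP : cf => /(_ A oA).
Qed.

Lemma GL2_entry_continuous i j : continuous (fun g : GL2 => GL2_mx g i j).
Proof.
move: i j; apply/continuous_mx.
exact: (@initial_continuous _ _ GL2_mx).
Qed.

Let GL2_mul_continuous : continuous (fun x : GL2 * GL2 => (x.1 * x.2)%g).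
Proof.
apply: continuous_initial; apply/continuous_mx => i j.
have -> : (fun x : GL2 * GL2 => GL2_mx (x.1 * x.2)%g i j) =
  fun x => \sum_k GL2_mx x.1 i k * GL2_mx x.2 k j.
  by apply/funext => x; rewrite /GL2_mx/= mxE.
elim: (index_enum _) => [|k r IH].
  by under eq_fun do rewrite big_nil; exact: cst_continuous.
under eq_fun do rewrite big_cons; apply: continuousD_val => //.
apply: continuousM_val => x.
  apply: (@continuous_comp _ _ _ fst (fun g => GL2_mx g i k)); first exact: cvg_fst.
  exact: GL2_entry_continuous.
apply: (@continuous_comp _ _ _ snd (fun g => GL2_mx g k j)); first exact: cvg_snd.
exact: GL2_entry_continuous.
Qed.

Let GL2_inv_continuous : continuous (fun x : GL2 => x^-1%g).
Proof.
apply: continuous_initial; apply/continuous_mx => i j.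
have det0 (g : GL2) : \det (GL2_mx g) != 0.
  by have := unit_groupP g; rewrite -[_ \is a _]/(_ \in unitmx) unitmxE unitfE.
have -> : (fun g : GL2 => GL2_mx g^-1%g i j) =
  fun g => (\det (GL2_mx g))^-1 *
   ((-1) ^+ (j + i) * \det (row' j (col' i (GL2_mx g)))).
  apply/funext => g; rewrite /GL2_mx/=.
  rewrite -[_^-1]/(invmx _) /invmx -[_ \in unitmx]/(_ \is a GRing.unit).
  by rewrite unit_groupP !mxE.
apply: continuousM_val.
  apply: continuousV_val => //; apply: continuous_det => a b.
  exact: GL2_entry_continuous.
apply: continuousM_val; first exact: cst_continuous.
apply: continuous_det => a b; under eq_fun do rewrite !mxE.
exact: GL2_entry_continuous.
Qed.

HB.instance Definition _ :=
  isTopologicalGroup.Build GL2 GL2_mul_continuous GL2_inv_continuous.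

Definition det_one : {pred GL2} := fun g : GL2 => \det (GL2_mx g) == 1.

Let det_one_closed : group_closed det_one.
Proof.
have E (g : GL2) : (g \in det_one) = (\det (GL2_mx g) == 1) by [].
split; first by rewrite E /GL2_mx /= det1.
move=> x y; rewrite !E => /eqP dx /eqP dy.
by rewrite /GL2_mx /= det_mulmx dx mul1r det_inv dy invr1.
Qed.

Definition SL2 : Type := {g : GL2 | g \in det_one}.
HB.instance Definition _ := [isSub of SL2 for @sval GL2 _].
HB.instance Definition _ := [Choice of SL2 by <:].
HB.instance Definition _ := SubChoice_isSubGroup.Build GL2 det_one SL2 det_one_closed.
HB.instance Definition _ :=
  Topological.copy SL2 (initial_topology (val : SL2 -> GL2)).

Let SL2_mul_continuous : continuous (fun x : SL2 * SL2 => (x.1 * x.2)%g).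
Proof.
have cval : continuous (val : SL2 -> GL2) by exact: initial_continuous.
apply: continuous_initial => x.
apply: (@continuous_comp _ _ _ (fun x : SL2 * SL2 => (val x.1, val x.2))
  (fun g : GL2 * GL2 => (g.1 * g.2)%g)); last exact: mulg_continuous.
apply: (@cvg_pair _ _ _ _ (nbhs (val x.1)) (nbhs (val x.2))).
  move=> A /cval hA; exists (val @^-1` A, setT); last by move=> y [].
  by split=> //; exact: filterT.
move=> A /cval hA; exists (setT, val @^-1` A); last by move=> y [].
by split=> //; exact: filterT.
Qed.

Let SL2_inv_continuous : continuous (fun x : SL2 => x^-1%g).
Proof.
apply: continuous_initial => x.
apply: (@continuous_comp _ _ _ (val : SL2 -> GL2) (fun g : GL2 => (g^-1)%g)).
  exact: initial_continuous.
exact: invg_continuous.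
Qed.

HB.instance Definition _ :=
  isTopologicalGroup.Build SL2 SL2_mul_continuous SL2_inv_continuous.

End Groups.

Record representation (k : fieldType) (G : groupType) := Representation {
  rep_space :> lmodType k;
  rep_act : G -> rep_space -> rep_space;
  rep_linear : forall g, linear (rep_act g);
  rep_act1 : forall v, rep_act 1%g v = v;
  rep_actM : forall g h v, rep_act (g * h)%g v = rep_act g (rep_act h v)
}.

Section Representations.
Variables (k : fieldType) (G : groupType).
Implicit Types V W : representation k G.

Record subrepresentation V := Subrepresentation {
  subrep_pred :> submodClosed V;
  subrep_stable : forall g v, v \in subrep_pred -> rep_act g v \in subrep_pred
}.

Definition irreducible V : Prop :=
  (exists v : V, v != 0) /\
  forall W : subrepresentation V,
    (forall v, v \in W -> v = 0) \/ (forall v, v \in W).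

Definition rep_isomorphism V W (phi : V -> W) : Prop :=
  [/\ linear phi, bijective phi &
      forall g v, phi (rep_act g v) = rep_act g (phi v)].

End Representations.

Section Restriction.
Variables (k : fieldType) (G : groupType) (S : pred G) (H : subGroupType S).
Variable V : representation k G.

Let act (h : H) (v : V) := rep_act (val h) v.
Let act1 v : act 1%g v = v.
Proof. by rewrite /act val1 rep_act1. Qed.
Let actM g h v : act (g * h)%g v = act g (act h v).
Proof. by rewrite /act valM rep_actM. Qed.

Definition rep_restrict : representation k H :=
  Representation (fun h => rep_linear (val h)) act1 actM.
End Restriction.

Section QuotientModule.
Variables (R : nzRingType) (V : lmodType R) (W : submodClosed V).
Local Open Scope quotient_scope.

Definition submod_pred : {pred V} := fun v : V => v \in W.
Let submod_pred_closed : zmod_closed submod_pred.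
Proof. exact: GRing.submod_closedB (submodClosedP W). Qed.
HB.instance Definition _ := GRing.isZmodClosed.Build V submod_pred submod_pred_closed.

Definition lmod_quot : Type := Quotient.quot submod_pred.
HB.instance Definition _ := GRing.Zmodule.on lmod_quot.
Definition lmod_pi (v : V) : lmod_quot := \pi_(Quotient.quot submod_pred) v.

Lemma lmod_piP x y : lmod_pi x = lmod_pi y <-> x - y \in W.
Proof.
rewrite -[x - y \in W]/(x - y \in submod_pred) Quotient.idealrBE.
by split=> [/eqP|/eqP].
Qed.

Definition lmod_repr (q : lmod_quot) : V := repr (q : Quotient.quot submod_pred).

Lemma lmod_reprK : cancel lmod_repr lmod_pi.
Proof. exact: reprK. Qed.

Lemma lmod_pi_surj q : exists v, lmod_pi v = q.
Proof. by exists (lmod_repr q); rewrite lmod_reprK. Qed.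

Lemma lmod_piD x y : lmod_pi (x + y) = lmod_pi x + lmod_pi y.
Proof. exact: (raddfD \pi_(Quotient.quot submod_pred)). Qed.

Let scale (a : R) (q : lmod_quot) : lmod_quot :=
  lmod_pi (a *: lmod_repr q).

Let pi_scale a v : scale a (lmod_pi v) = lmod_pi (a *: v).
Proof.
by apply/lmod_piP; rewrite -scalerBr rpredZ//; apply/lmod_piP; rewrite lmod_reprK.
Qed.

Let scaleA a b q : scale a (scale b q) = scale (a * b) q.
Proof. by have [v <-] := lmod_pi_surj q; rewrite !pi_scale scalerA. Qed.
Let scale1 : left_id 1 scale.
Proof. by move=> q; have [v <-] := lmod_pi_surj q; rewrite !pi_scale scale1r. Qed.
Let scaleDr : right_distributive scale +%R.
Proof.
move=> a q r; have [v <-] := lmod_pi_surj q; have [w <-] := lmod_pi_surj r.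
by rewrite -lmod_piD !pi_scale scalerDr lmod_piD.
Qed.
Let scaleDl q : {morph scale^~ q : a b / a + b}.
Proof.
by move=> a b; have [v <-] := lmod_pi_surj q; rewrite !pi_scale scalerDl lmod_piD.
Qed.

HB.instance Definition _ :=
  GRing.Zmodule_isLmodule.Build R lmod_quot scaleA scale1 scaleDr scaleDl.

Lemma lmod_piZ a x : lmod_pi (a *: x) = a *: lmod_pi x.
Proof. by rewrite -pi_scale. Qed.
End QuotientModule.

Section QuotientRepresentation.
Variables (k : fieldType) (G : groupType) (V : representation k G).
Variable W : subrepresentation V.

Let act (g : G) (q : lmod_quot W) : lmod_quot W :=
  lmod_pi W (rep_act g (lmod_repr q)).

Let actE g v : act g (lmod_pi W v) = lmod_pi W (rep_act g v).
Proof.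
apply/lmod_piP; set w := lmod_repr _.
have -> : rep_act g w - rep_act g v = rep_act g (w - v).
  by rewrite addrC -scaleN1r -(rep_linear g) addrC scaleN1r.
by apply: subrep_stable; apply/lmod_piP; rewrite lmod_reprK.
Qed.

Let act_linear g : linear (act g).
Proof.
move=> a q r; have [v <-] := lmod_pi_surj q; have [w <-] := lmod_pi_surj r.
by rewrite -lmod_piZ -lmod_piD !actE rep_linear lmod_piD lmod_piZ.
Qed.
Let act1 q : act 1%g q = q.
Proof. by have [v <-] := lmod_pi_surj q; rewrite actE rep_act1. Qed.
Let actM g h q : act (g * h)%g q = act g (act h q).
Proof. by have [v <-] := lmod_pi_surj q; rewrite !actE rep_actM. Qed.

Definition rep_quot : representation k G := Representation act_linear act1 actM.
Definition rep_pi (v : V) : rep_quot := lmod_pi W v.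

Lemma rep_act_pi g v : rep_act g (rep_pi v) = rep_pi (rep_act g v).
Proof. exact: actE. Qed.
End QuotientRepresentation.

Definition locally_constant (T : topologicalType) (U : Type) (f : T -> U) : Prop :=
  forall x, \forall y \near x, f y = f x.

(* [chi] is only required to be a function on B: its multiplicativity and     *)
(* smoothness are not needed for the definition to make sense.                *)
Section Induction.
Variables (k : fieldType) (G : topologicalGroupType) (B : {pred G}).
Variable chi : {b : G | b \in B} -> unit_group k.

Definition ind_pred : {pred G -> k^o} := fun f : G -> k^o =>
  `[< locally_constant f /\
      forall (b : {b : G | b \in B}) (g : G),
        f (val b * g)%g = unit_group_val (chi b) * f g >].

Lemma ind_predP (f : G -> k^o) : reflect (locally_constant f /\
      forall (b : {b : G | b \in B}) (g : G),
        f (val b * g)%g = unit_group_val (chi b) * f g) (f \in ind_pred).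
Proof. exact: asboolP. Qed.

Let ind_submod : submod_closed ind_pred.
Proof.
split.
  apply/ind_predP; split=> [x|b g]; first exact: nearW.
  by rewrite mulr0.
move=> a u v /ind_predP[lu hu] /ind_predP[lv hv]; apply/ind_predP; split.
  move=> x; have := lu x; apply: filterS2 (lv x) => y E1 E2.
  by rewrite -[LHS]/(a * u y + v y) E1 E2.
move=> b g; rewrite -[LHS]/(a * u _ + v _) hu hv -[(_ + _) g]/(a * u g + v g).
by rewrite mulrDr mulrCA.
Qed.
HB.instance Definition _ := GRing.isSubmodClosed.Build k (G -> k^o) ind_pred ind_submod.

Definition ind_space : Type := {f : G -> k^o | f \in ind_pred}.
HB.instance Definition _ := [isSub of ind_space for @sval (G -> k^o) _].
HB.instance Definition _ := [Choice of ind_space by <:].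
HB.instance Definition _ := [SubChoice_isSubLmodule of ind_space by <:].

Let translate_subproof (h : G) (f : ind_space) :
  (fun g => val f (g * h)%g) \in ind_pred.
Proof.
have /ind_predP[lf hf] := valP f.
apply/ind_predP; split=> [x|b g]; last by rewrite -mulgA hf.
have ch : {for x, continuous (fun g : G => (g * h)%g)}.
  apply: (@continuous_comp _ _ _ (fun g : G => (g, h)) (fun z : G * G => (z.1 * z.2)%g)).
    by apply: (@cvg_pair _ _ _ _ (nbhs x) (nbhs h)); [exact: cvg_id|exact: cvg_cst].
  exact: mulg_continuous.
exact: (ch _ (lf (x * h)%g)).
Qed.

Let act (h : G) (f : ind_space) : ind_space :=
  Sub (fun g => val f (g * h)%g) (translate_subproof h f).

Let act_linear h : linear (act h).
Proof. by move=> a u v; apply: val_inj; apply/funext. Qed.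
Let act1 f : act 1%g f = f.
Proof. by apply: val_inj; apply/funext => g /=; rewrite mulg1. Qed.
Let actM g h f : act (g * h)%g f = act g (act h f).
Proof. by apply: val_inj; apply/funext => x /=; rewrite mulgA. Qed.

Definition ind : representation k G := Representation act_linear act1 actM.
Definition ind_fun (f : ind) : G -> k := val (f : ind_space).

Lemma ind_act (h : G) (f : ind) (g : G) : ind_fun (rep_act h f) g = ind_fun f (g * h)%g.
Proof. by []. Qed.

Definition constant_pred : {pred ind} := fun f : ind =>
  `[< exists c : k, forall g, ind_fun f g = c >].

Let constant_submod : submod_closed constant_pred.
Proof.
split; first by apply/asboolP; exists 0.
move=> a u v /asboolP[c hc] /asboolP[d hd]; apply/asboolP; exists (a * c + d) => g.
by rewrite -(hc g) -(hd g).
Qed.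
HB.instance Definition _ := GRing.isSubmodClosed.Build k ind constant_pred constant_submod.

Let constant_stable g (v : ind) : v \in constant_pred -> rep_act g v \in constant_pred.
Proof. by move=> /asboolP[c hc]; apply/asboolP; exists c => x; exact: hc. Qed.

Definition constants : subrepresentation ind := Subrepresentation constant_stable.
End Induction.

Section PrincipalSeries.
Variables (k : fieldType) (F : completeDVFieldType).

(* Openness of the kernel is smoothness for a character. *)
Definition smooth_character (eta : {multiplicative Fx F -> unit_group k}) : Prop :=
  open (eta @^-1` [set 1%g]).

Definition borel : {pred GL2 F} := fun g : GL2 F => GL2_mx g 1 0 == 0.
Definition borelS : {pred SL2 F} := fun g : SL2 F => val g \in borel.

Lemma borel_diag_unit (g : GL2 F) i : g \in borel -> GL2_mx g i i \is a GRing.unit.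
Proof.
move=> /eqP g10; have : GL2_mx g \in unitmx by exact: unit_groupP g.
rewrite unitmxE -det_tr det_trig; last first.
  apply/is_trig_mxP => -[[|[|//]] hi] [[|[|//]] hj] //= _; rewrite mxE -[RHS]g10.
  by congr (GL2_mx g _ _); exact: val_inj.
rewrite !big_ord_recl big_ord0 mulr1 unitrM !mxE => /andP[u0 u1].
case: i => -[|[|//]] hi.
  by rewrite (_ : Ordinal hi = ord0) //; exact: val_inj.
by rewrite (_ : Ordinal hi = lift ord0 ord0) //; exact: val_inj.
Qed.

Definition borel_diag (b : {b : GL2 F | b \in borel}) (i : 'I_2) : Fx F :=
  UnitGroup (borel_diag_unit i (valP b)).

Definition tensor_char (eta1 eta2 : Fx F -> unit_group k)
  (b : {b : GL2 F | b \in borel}) : unit_group k :=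
  (eta1 (borel_diag b 0) * eta2 (borel_diag b 1))%g.

Definition borelS_incl (b : {b : SL2 F | b \in borelS}) :
  {b : GL2 F | b \in borel} := exist _ (val (val b)) (valP b).

Definition borelS_char (eta : Fx F -> unit_group k)
  (b : {b : SL2 F | b \in borelS}) : unit_group k :=
  eta (borel_diag (borelS_incl b) 0).

Definition trivial_char (T : Type) : T -> unit_group k := fun=> 1%g.

Definition IndG chi : representation k (GL2 F) := ind (B := borel) chi.
Definition IndS chi : representation k (SL2 F) := ind (B := borelS) chi.

Definition Sp : representation k (GL2 F) :=
  rep_quot (constants (B := borel) (@trivial_char _)).
Definition SpS : representation k (SL2 F) :=
  rep_quot (constants (B := borelS) (@trivial_char _)).

Definition is_restriction chi chiS (f : IndG chi) (fS : IndS chiS) : Prop :=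
  forall s : SL2 F, ind_fun fS s = ind_fun f (val s).
End PrincipalSeries.

Definition algebraic_over_Fp (p : nat) (k : fieldType) : Prop :=
  exists iota : {rmorphism 'F_p -> k}, forall x : k, algebraicOver iota x.

(* Main.v *)
(** Every [g] in [GL_2(F)] factors uniquely as [diag(1, det g) * s] with [s] in [SL_2(F)].
    A character of [B] that only depends on the upper left entry is trivial on
    [diag(1, det g)], so a function in the representation induced from [B] is determined by
    its restriction to [SL_2(F)], and [g |-> fS s] extends any function [fS] in the
    representation induced from [B_S]. Restriction and extension both preserve constant
    functions, so the isomorphism passes to the Steinberg quotients. *)
Require Import Defs.
From HB Require Import structures.
From mathcomp Require Import all_boot all_order all_algebra.
From mathcomp Require Import boolp classical_sets functions cardinality.
From mathcomp Require Import topology.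

Set Implicit Arguments.
Unset Strict Implicit.
Unset Printing Implicit Defensive.
Local Open Scope classical_set_scope.
Local Open Scope ring_scope.
Import GRing.Theory.

Lemma det_mx22 (R : comPzRingType) (A : 'M[R]_2) :
  \det A = A 0 0 * A 1 1 - A 0 1 * A 1 0.
Proof.
have h1 : lift ord0 ord0 = 1 :> 'I_2 by exact: val_inj.
have h0 : lift 1 ord0 = 0 :> 'I_2 by exact: val_inj.
by rewrite (expand_det_row _ 0) !big_ord_recl big_ord0 addr0 /cofactor !det_mx11
  !mxE /= h1 h0 expr0 mul1r expr1 mulN1r mulrN.
Qed.

Lemma locally_constant_comp (T S : topologicalType) (U : Type) (h : T -> S) (f : S -> U) :
  continuous h -> locally_constant f -> locally_constant (f \o h).
Proof. by move=> ch lf x; exact: (ch x _ (lf (h x))). Qed.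

(** * Isomorphisms induced on quotient representations *)

Section QuotientIsomorphism.
Variables (k : fieldType) (G : groupType) (S : pred G) (H : subGroupType S).
Variables (V : representation k G) (W : subrepresentation V).
Variables (V' : representation k H) (W' : subrepresentation V').
Variable phi : rep_restrict H V -> V'.

(** The equivalence between [phi v \in W'] and [v \in W] is used in both directions: one makes [phi]
    descend to the quotients, the other makes its inverse descend. *)
Lemma rep_quot_isomorphism : rep_isomorphism phi ->
  (forall v : V, (phi v \in W') = (v \in W)) ->
  exists psi : rep_restrict H (rep_quot W) -> rep_quot W',
    rep_isomorphism psi /\ forall v : V, psi (rep_pi W v) = rep_pi W' (phi v).
Proof.
move=> [phi_lin [phi' phiK phi'K] phi_act] phiW.
have phiB (x y : V) : phi (x - y) = phi x - phi y.
  by rewrite addrC -scaleN1r phi_lin scaleN1r addrC.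
pose psi (q : rep_restrict H (rep_quot W)) : rep_quot W' :=
  rep_pi W' (phi (lmod_repr q)).
have psiE (v : V) : psi (rep_pi W v) = rep_pi W' (phi v).
  apply/lmod_piP; rewrite -phiB phiW; apply/lmod_piP; exact: lmod_reprK.
exists psi; split=> //; split.
- move=> a q r; have [v <-] := lmod_pi_surj q; have [w <-] := lmod_pi_surj r.
  rewrite -[_ *: _ + _]/(a *: lmod_pi W v + lmod_pi W w) -lmod_piZ -lmod_piD.
  by rewrite !psiE phi_lin /rep_pi lmod_piD lmod_piZ.
- pose psi' (q : rep_quot W') : rep_restrict H (rep_quot W) :=
    rep_pi W (phi' (lmod_repr q)).
  exists psi' => q.
    have [v <-] := lmod_pi_surj q; rewrite psiE /psi'.
    apply/lmod_piP; rewrite -phiW phiB phi'K; apply/lmod_piP; exact: lmod_reprK.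
  by rewrite /psi' psiE phi'K; exact: lmod_reprK.
- move=> g q; have [v <-] := lmod_pi_surj q.
  by rewrite [rep_act g _](rep_act_pi W (val g) v) !psiE rep_act_pi -phi_act.
Qed.

End QuotientIsomorphism.

(** * The factor in $SL_2(F)$ of an element of $GL_2(F)$ *)

Section SpecialPart.
Variable F : completeDVFieldType.
Implicit Types (g : GL2 F) (b : {b : GL2 F | b \in @borel F}).

Lemma GL2_det_neq0 g : \det (GL2_mx g) != 0.
Proof.
have := unit_groupP g; rewrite -[_ \is a _]/(_ \in unitmx) unitmxE.
by rewrite GRing.unitfE.
Qed.

Lemma GL2_mxM g h : GL2_mx (g * h)%g = GL2_mx g *m GL2_mx h.
Proof. by []. Qed.

Lemma GL2_mx_inj : injective (@GL2_mx F).
Proof. exact: val_inj. Qed.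

(** This is $diag(1, \det g)^{-1} g$: the lower row is divided by the determinant. *)
Definition special_part_mx g : 'M[F]_2 :=
  \matrix_(i, j) (if i == 0 then GL2_mx g i j else (\det (GL2_mx g))^-1 * GL2_mx g i j).

Lemma det_special_part_mx g : \det (special_part_mx g) = 1.
Proof.
rewrite det_mx22 !mxE /= mulrCA [_ * (_ * GL2_mx g 1 0)]mulrCA -mulrBr -det_mx22.
by rewrite mulVf // GL2_det_neq0.
Qed.

Lemma special_part_unit g : special_part_mx g \is a GRing.unit.
Proof.
rewrite -[_ \is a _]/(_ \in unitmx) unitmxE det_special_part_mx; exact: unitr1.
Qed.

Lemma special_part_det_one g : UnitGroup (special_part_unit g) \in @det_one F.
Proof. by apply/eqP; exact: det_special_part_mx. Qed.

Definition special_part g : SL2 F :=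
  exist (fun h => h \in @det_one F) _ (special_part_det_one g).

(** Needed for extensions of locally constant functions to be locally constant. *)
Lemma special_part_continuous : continuous special_part.
Proof.
(* The topology of $SL_2(F)$ is induced from $GL_2(F)$, whose own topology is induced from matrices;
   hence two reductions before looking at entries. *)
apply: continuous_initial; apply: continuous_initial; apply/continuous_mx => i j.
have -> : (fun g : GL2 F => unit_group_val (val (special_part g)) i j) =
    fun g => if i == 0 then GL2_mx g i j else (\det (GL2_mx g))^-1 * GL2_mx g i j.
  by apply/funext => g; rewrite /= mxE.
case: (i == 0); first exact: GL2_entry_continuous.
apply: continuousM_val; last exact: GL2_entry_continuous.
apply: continuousV_val => [g|]; first exact: GL2_det_neq0.
by apply: continuous_det => a c; exact: GL2_entry_continuous.
Qed.

Lemma special_part_val (s : SL2 F) : special_part (val s) = s.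
Proof.
apply/val_inj/GL2_mx_inj/matrixP => i j; rewrite mxE.
by rewrite (eqP (valP s)) invr1 mul1r if_same.
Qed.

(** Right multiplication by $s$ leaves $\det g$ unchanged, so the same row scaling applies on both
    sides. *)
Lemma special_partM g (s : SL2 F) :
  special_part (g * val s)%g = (special_part g * s)%g.
Proof.
apply/val_inj/GL2_mx_inj/matrixP => i j.
rewrite mxE GL2_mxM det_mulmx (eqP (valP s)) mulr1 [RHS]mxE.
by under [RHS]eq_bigr do rewrite mxE; rewrite mxE; case: (i == 0);
  rewrite ?mulr_sumr //; apply: eq_bigr => l _; rewrite mulrA.
Qed.

Definition diag_det_mx g : 'M[F]_2 :=
  \matrix_(i, j) (if i == j then if i == 0 then 1 else \det (GL2_mx g) else 0).

Lemma diag_det_unit g : diag_det_mx g \is a GRing.unit.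
Proof.
rewrite -[_ \is a _]/(_ \in unitmx) unitmxE det_mx22 !mxE /= mul1r mulr0 subr0.
by rewrite unitfE GL2_det_neq0.
Qed.

Definition diag_det g : GL2 F := UnitGroup (diag_det_unit g).

Lemma diag_det_borel g : diag_det g \in @borel F.
Proof. by apply/eqP; rewrite mxE. Qed.

Lemma sum_ord2 (f : 'I_2 -> F) : \sum_i f i = f 0 + f 1.
Proof. by rewrite !big_ord_recl big_ord0 addr0; congr (_ + f _); exact: val_inj. Qed.

Lemma diag_detM_special_part g : (diag_det g * val (special_part g))%g = g.
Proof.
apply/GL2_mx_inj/matrixP => i j; rewrite GL2_mxM mxE sum_ord2 !mxE /=.
have [->|->] : i = 0 \/ i = 1.
  by case: i => -[|[|//]] hi; [left|right]; exact: val_inj.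
- by rewrite /= mul1r mul0r addr0.
- by rewrite /= mul0r add0r mulrA divff ?GL2_det_neq0 // mul1r.
Qed.

Lemma borelM g h : g \in @borel F -> h \in @borel F ->
  (g * h)%g \in @borel F /\ GL2_mx (g * h)%g 0 0 = GL2_mx g 0 0 * GL2_mx h 0 0.
Proof.
move=> /eqP hg /eqP hh; split; last by rewrite GL2_mxM mxE sum_ord2 hh mulr0 addr0.
by apply/eqP; rewrite GL2_mxM mxE sum_ord2 hg hh mul0r mulr0 addr0.
Qed.

Lemma special_part_borel g : g \in @borel F -> special_part g \in @borelS F.
Proof. by move=> /eqP hg; apply/eqP; rewrite mxE /= hg mulr0. Qed.

(** Write $g = d s$ with $d = diag(1, \det g)$. Then $bg = (bd)s$ with $bd$ in $B$, and $c$ is the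
    special part of $bd$. Neither $d$ nor the scaling of the lower row affects the upper left entry.
    This turns equivariance under $B_S$ into equivariance under $B$. *)
Lemma special_part_borelM b g : exists2 c : {c : SL2 F | c \in @borelS F},
  special_part (val b * g)%g = (val c * special_part g)%g &
  borel_diag (borelS_incl c) 0 = borel_diag b 0.
Proof.
have [hB h00] := borelM (valP b) (diag_det_borel g).
exists (exist (fun s => s \in @borelS F) _ (special_part_borel hB)).
  by rewrite -special_partM -mulgA diag_detM_special_part.
apply: val_inj; transitivity (GL2_mx (val b * diag_det g)%g 0 0); first exact: mxE.
by rewrite h00 [X in _ * X]mxE mulr1.
Qed.

End SpecialPart.

(** * Restriction of induced functions to $SL_2(F)$ and its inverse *)

Section Restriction.
Variables (k : fieldType) (F : completeDVFieldType).
Variable eta : Fx F -> unit_group k.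
Hypothesis eta1 : eta 1%g = 1%g.

(** A common form for $\eta \otimes \mathbf 1$ and, with $\eta$ trivial, for the trivial character
    of $B$. *)
Definition upper_left_char (b : {b : GL2 F | b \in @borel F}) : unit_group k :=
  eta (borel_diag b 0).

Lemma restriction_subproof (f : IndG upper_left_char) :
  (ind_fun f \o val : SL2 F -> k^o) \in ind_pred (borelS_char eta).
Proof.
have /ind_predP[lf hf] := valP f; apply/ind_predP; split.
  by apply: locally_constant_comp lf; exact: initial_continuous.
by move=> b g; exact: (hf (borelS_incl b) (val g)).
Qed.

Definition restriction (f : rep_restrict (SL2 F) (IndG upper_left_char)) :
  IndS (borelS_char eta) :=
  (Sub (_ \o _) (restriction_subproof f) : ind_space (borelS_char eta)).

Lemma extension_subproof (f : IndS (borelS_char eta)) :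
  (ind_fun f \o @special_part F : GL2 F -> k^o) \in ind_pred upper_left_char.
Proof.
have /ind_predP[lf hf] := valP f; apply/ind_predP; split.
  by apply: locally_constant_comp lf; exact: special_part_continuous.
move=> b g /=; have [c -> hc] := special_part_borelM b g.
by rewrite /ind_fun hf /borelS_char hc.
Qed.

Definition extension (f : IndS (borelS_char eta)) :
  rep_restrict (SL2 F) (IndG upper_left_char) :=
  (Sub (_ \o _) (extension_subproof f) : ind_space upper_left_char).

(** The factor $diag(1, \det g)$ acts through $\eta(1) = 1$. Hence $f$ is recovered from its
    restriction. *)
Lemma ind_fun_special_part (f : IndG upper_left_char) g :
  ind_fun f (val (special_part g)) = ind_fun f g.
Proof.
have /ind_predP[_ hf] := valP f.
pose d : {b : GL2 F | b \in @borel F} :=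
  exist (fun b => b \in @borel F) _ (diag_det_borel g).
have := hf d (val (special_part g)); rewrite diag_detM_special_part.
rewrite /upper_left_char (_ : borel_diag d 0 = 1%g); last first.
  by apply: val_inj; rewrite /= mxE.
by rewrite eta1 mul1r.
Qed.

Lemma restriction_isomorphism : rep_isomorphism restriction.
Proof.
split.
- by move=> a u v; apply: val_inj.
- exists extension => f; apply: val_inj; apply/funext => x.
    exact: ind_fun_special_part.
  exact: (congr1 (ind_fun f) (special_part_val x)).
- by move=> g f; apply: val_inj.
Qed.

Lemma is_restrictionE (f : IndG upper_left_char) (fS : IndS (borelS_char eta)) :
  is_restriction f fS -> restriction f = fS.
Proof. by move=> h; apply: val_inj; apply/funext => s; exact: (esym (h s)). Qed.

(** Every value of $f$ is already taken on $SL_2(F)$, so a constant restriction forces $f$ to be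
    constant. *)
Lemma restriction_constants (f : IndG upper_left_char) :
  (restriction f \in constants (borelS_char eta)) = (f \in constants upper_left_char).
Proof.
apply/asboolP/asboolP => -[c hc]; exists c => g; last exact: hc.
by rewrite -ind_fun_special_part; exact: hc.
Qed.

End Restriction.

Theorem mainTheorem2
  (p : nat) (p_prime : prime p)
  (F : completeDVFieldType)
  (F_residue_char : p \in [pchar (residue_field F)])
  (F_residue_finite : finite_set [set: residue_field F])
  (k : closedFieldType) (k_Fpbar : algebraic_over_Fp p k) :
  [/\ forall eta : {multiplicative Fx F -> unit_group k},
        smooth_character eta ->
        irreducible (IndG (tensor_char eta (@trivial_char k _))) ->
        exists phi : rep_restrict (SL2 F) (IndG (tensor_char eta (@trivial_char k _))) ->
                     IndS (borelS_char eta),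
          rep_isomorphism phi /\ forall f, is_restriction f (phi f),
      exists phi : rep_restrict (SL2 F) (Sp k F) -> SpS k F,
        rep_isomorphism phi /\
        forall (f : IndG (@trivial_char k _))
               (fS : IndS (@trivial_char k _)),
          is_restriction f fS -> phi (rep_pi _ f) = rep_pi _ fS
    & exists phi : rep_restrict (SL2 F) (IndG (@trivial_char k _)) ->
                   IndS (@trivial_char k _),
        rep_isomorphism phi /\ forall f, is_restriction f (phi f)].
Proof.
have trivial1 : @trivial_char k (Fx F) 1%g = 1%g by [].
split.
- move=> eta _ _.
  have -> : tensor_char eta (@trivial_char k _) = upper_left_char eta.
    by apply/funext => b; exact: mulg1.
  exists (@restriction k F eta); split=> [|f s //].
  apply: restriction_isomorphism.
  (* $\eta(1) = 1$ follows by cancelling $\eta(1)$ in $\eta(1)\eta(1) = \eta(1)$. *)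
  by apply: (@mulgI _ (eta 1%g)); rewrite -gmulfM !mulg1.
(* For trivial $\eta$, [upper_left_char] and [borelS_char] compute to the trivial characters, so the
   general results apply by conversion. *)
- have [psi [psi_iso psiE]] := rep_quot_isomorphism
    (restriction_isomorphism trivial1) (restriction_constants trivial1).
  exists psi; split=> // f fS ffS.
  by rewrite -(is_restrictionE (eta := @trivial_char k _) ffS); exact: psiE.
- exists (@restriction k F (@trivial_char k _)); split=> [|f s //].
  exact: restriction_isomorphism trivial1.
Qed.
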